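(* Let $\omega$ be a Cayley permutation of length $n\geq3$. The relational structure $R(\omega)$ is indecomposable if and only if $\omega$ is simple and primitive.
   Context: Write $[n]=\{1,\ldots,n\}$. A Cayley permutation of length $n$ is a word $\omega=w_1\cdots w_n$ of positive integers whose set of letters is $[m]$ for some $m\leq n$; equivalently a map $\omega:[n]\to[n]$, $\omega(i)=w_i$, with image $[m]$. A nonempty interval of positions $I=[a,b]\subseteq[n]$ is an H-interval of $\omega$ if there is an interval of values $J=[c,d]$ with $\omega(I)=J$ and $\omega^{-1}(J)=I$. $\omega$ is simple if every H-interval of $\omega$ is a singleton or equals $[n]$. $\omega$ is primitive if it has no two equal adjacent letters. $R(\omega)=([n],<_1,<_2)$ is the relational structure on $[n]$ with the two binary relations $i<_1j$ iff $i<j$, and $i<_2j$ iff $\omega(i)<\omega(j)$. A module of a relational structure (a set with binary relations) is a subset $M$ of the ground set such that for every relation $R$, all $i,j\in M$ and all $x\notin M$: $iRx\Leftrightarrow jRx$ and $xRi\Leftrightarrow xRj$. A module is nontrivial if it has at least two elements and is a proper subset of the ground set. The structure is indecomposable if it has no nontrivial module. *)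

(* Defs.v *)
From mathcomp Require Import all_boot.

Set Implicit Arguments.
Unset Strict Implicit.
Unset Printing Implicit Defensive.

Record rel_structure := RelStructure {
  ground :> finType;
  rel_index : Type;
  rel_of : rel_index -> rel ground
}.

Definition is_module (S : rel_structure) (M : {set S}) : Prop :=
  forall (k : rel_index S) (i j x : S),
    i \in M -> j \in M -> x \notin M ->
    (rel_of k i x <-> rel_of k j x) /\ (rel_of k x i <-> rel_of k x j).

Definition nontrivial (S : rel_structure) (M : {set S}) : Prop :=
  2 <= #|M| /\ M \proper [set: S].

Definition indecomposable (S : rel_structure) : Prop :=
  ~ exists M : {set S}, is_module M /\ nontrivial M.

(* Words of length n are n.-tuples of naturals: letters keep the values
   1, 2, ..., while the position i of [n] is the ordinal i - 1 of 'I_n. *)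
Definition cayley (n : nat) (w : n.-tuple nat) : Prop :=
  exists2 m : nat, m <= n & forall k : nat, (k \in w) = (1 <= k <= m).

Definition H_interval (n : nat) (w : n.-tuple nat) (I : {set 'I_n}) : Prop :=
  (exists a b : 'I_n, a <= b /\ I = [set i : 'I_n | a <= i <= b]) /\
  (exists c d : nat,
     [seq tnth w i | i in I] =i [pred k : nat | c <= k <= d] /\
     [set i : 'I_n | c <= tnth w i <= d] = I).

Definition simple_word (n : nat) (w : n.-tuple nat) : Prop :=
  forall I : {set 'I_n}, H_interval w I -> #|I| = 1 \/ I = [set: 'I_n].

Definition primitive_word (n : nat) (w : n.-tuple nat) : Prop :=
  forall i j : 'I_n, j = i.+1 :> nat -> tnth w i <> tnth w j.

(* false indexes the order on positions, true the strict weak order on values *)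
Definition word_structure (n : nat) (w : n.-tuple nat) : rel_structure :=
  RelStructure (fun by_value : bool =>
    if by_value then [rel i j : 'I_n | tnth w i < tnth w j]
    else [rel i j : 'I_n | i < j]).

(* Main.v *)
Require Import Defs.
From mathcomp Require Import all_boot.
From mathcomp Require Import zify.

(** Every H-interval is a module, and so is a pair of equal adjacent letters.
    Conversely, let [M] be a nontrivial module. The order on positions makes [M]
    an interval. If some position outside [M] carried the same letter as a
    position of [M], the word would be constant on [M], hence would repeat a
    letter at two adjacent positions of [M]. So for a primitive word every letter
    outside [M] lies strictly below or strictly above all letters of [M]; as the
    letters of a Cayley permutation have no gaps, [M] is an H-interval. *)

(** A position outside [I] lies on one side of [[a, b]]; its letter falls outside [[c, d]], hence on
    one side of it. *)
Lemma H_interval_module (n : nat) (w : n.-tuple nat) (I : {set 'I_n}) :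
  H_interval w I -> is_module (S := word_structure w) I.
Proof.
move=> [[a [b [_ defI]]] [c [d [_ preI]]]] [] i j x; first last.
  by rewrite defI !inE /= => *; split; lia.
by rewrite -preI !inE /= => *; split; lia.
Qed.

(** No position fits strictly between [i] and [j], and equal letters compare alike with any third
    one. *)
Lemma adjacent_module {n : nat} {w : n.-tuple nat} {i j : 'I_n} :
  j = i.+1 :> nat -> tnth w i = tnth w j ->
  is_module (S := word_structure w) [set i; j].
Proof.
move=> ji wij k u v x; rewrite !inE negb_or -!val_eqE /= => Hu Hv /andP[xi xj].
case: k => /=.
  have wE y : (val y == val i) || (val y == val j) -> tnth w y = tnth w i.
    by case/orP => /eqP/val_inj ->.
  by rewrite (wE u Hu) (wE v Hv).
by split; lia.
Qed.

Lemma module_convex {n : nat} {w : n.-tuple nat} {M : {set 'I_n}}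
    {i j x : 'I_n} :
  is_module (S := word_structure w) M ->
  i \in M -> j \in M -> i <= x <= j -> x \in M.
Proof.
move=> modM iM jM /andP[ix xj]; apply/negPn/negP => xM.
have xi : x != i by apply: contraNneq xM => ->.
have xj' : x != j by apply: contraNneq xM => ->.
(* If [i < x < j], the module condition turns [i < x] into [j < x]. *)
have [+ _] := modM false i j x iM jM xM.
by move: xi xj'; rewrite -!val_eqE /=; lia.
Qed.

Lemma module_interval {n : nat} {w : n.-tuple nat} {M : {set 'I_n}} :
  is_module (S := word_structure w) M -> M != set0 ->
  exists a b : 'I_n, a <= b /\ M = [set i : 'I_n | a <= i <= b].
Proof.
move=> modM /set0Pn[i0 i0M].
case: (@arg_minnP _ i0 (mem M) val i0M) => a aM amin.
case: (@arg_maxnP _ i0 (mem M) val i0M) => b bM bmax.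
exists a, b; split; first exact: amin.
apply/setP => i; rewrite inE; apply/idP/idP => [iM | ].
  by apply/andP; split; [exact: amin | exact: bmax].
exact: module_convex modM aM bM.
Qed.

Lemma primitive_module_sep {n : nat} {w : n.-tuple nat} {M : {set 'I_n}}
    {i x : 'I_n} :
  primitive_word w -> is_module (S := word_structure w) M -> 1 < #|M| ->
  i \in M -> x \notin M -> tnth w i <> tnth w x.
Proof.
move=> prim modM /card_gt1P[u [v [uM vM uv]]] iM xM wix.
(* The letter at [x] is neither below nor above that at [i], so the same holds at [j]. *)
have wM j : j \in M -> tnth w j = tnth w x.
  by move=> jM; have /= := modM true i j x iM jM xM; lia.
wlog lt_uv : u v uM vM uv / u < v.
  move=> H; move: (uv); rewrite -val_eqE neq_ltn => /orP[] lt.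
    exact: H uM vM uv lt.
  by rewrite eq_sym in uv; exact: H vM uM uv lt.
(* The position after [u] is at most [v], so convexity puts it in [M]. *)
pose u' : 'I_n := Ordinal (leq_ltn_trans lt_uv (ltn_ord v)).
have u'M : u' \in M.
  by apply: (module_convex modM uM vM); rewrite /= lt_uv leqnSn.
by apply: (prim u u') => //; rewrite !wM.
Qed.

Lemma primitive_module_H_interval {n : nat} {w : n.-tuple nat}
    {M : {set 'I_n}} :
  cayley w -> primitive_word w -> is_module (S := word_structure w) M ->
  1 < #|M| -> H_interval w M.
Proof.
move=> [m _ wP] prim modM M_gt1.
have M0 : M != set0 by rewrite -card_gt0 ltnW.
split; first exact: module_interval modM M0.
have /set0Pn[i0 i0M] := M0.
case: (@arg_minnP _ i0 (mem M) (tnth w) i0M) => a aM amin.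
case: (@arg_maxnP _ i0 (mem M) (tnth w) i0M) => b bM bmax.
have preM i : (tnth w a <= tnth w i <= tnth w b) = (i \in M).
  apply/idP/idP => [wi | iM].
    apply/negPn/negP => iM.
    (* Separation makes both bounds on [tnth w i] strict, yet [i] must compare alike with [a] and
       [b]. *)
    have /= := modM true a b i aM bM iM.
    have := primitive_module_sep prim modM M_gt1 aM iM.
    have := primitive_module_sep prim modM M_gt1 bM iM.
    lia.
  by apply/andP; split; [exact: amin | exact: bmax].
exists (tnth w a), (tnth w b); split; last first.
  by apply/setP => i; rewrite inE preM.
move=> k; rewrite inE; apply/imageP/idP => [[i iM ->] | wk].
  by rewrite preM.
(* The letters fill [[1, m]], so a value between two letters is a letter. *)
have : k \in w.
  move: wk (mem_tnth a w) (mem_tnth b w); rewrite !wP.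
  move=> /andP[ak kb] /andP[a_gt0 _] /andP[_ bm].
  by rewrite (leq_trans a_gt0 ak) (leq_trans kb bm).
case/tnthP => i ki; exists i => //.
by rewrite ki preM in wk.
Qed.

Theorem proposition5p2 (n : nat) (w : n.-tuple nat)
  (hn : 3 <= n) (hw : cayley w) :
  indecomposable (word_structure w) <-> simple_word w /\ primitive_word w.
Proof.
split=> [indec | [simp prim] [M [modM [M_gt1 Mproper]]]]; last first.
  have [M1 | MT] := simp M (primitive_module_H_interval hw prim modM M_gt1).
    by rewrite M1 in M_gt1.
  by rewrite MT properxx in Mproper.
split=> [I HI | i j ji wij].
  have [-> | IT] := eqVneq I [set: 'I_n]; first by right.
  left; have [[a [b [le_ab defI]]] _] := HI.
  have I_gt0 : 0 < #|I|.
    by apply/card_gt0P; exists a; rewrite defI inE leqnn.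
  apply/eqP; rewrite eqn_leq I_gt0 andbT leqNgt; apply/negP => I_gt1.
  apply: indec; exists I; split; first exact: H_interval_module.
  by split=> //; rewrite properT.
apply: indec; exists [set i; j]; split; first exact: adjacent_module.
have ij : i != j by rewrite -val_eqE /= ji ltn_eqF.
split; first by rewrite cards2 ij.
(* A pair filling the ground set would force [n = 2]. *)
rewrite properT; apply: contraTneq hn => ijT.
by rewrite -[n]card_ord -cardsT -ijT cards2 ij.
Qed.
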